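(* Let $X_1$ and $X_2$ be two strong fuzzy incidence graphs. Then the Cartesian product $X_1\times X_2$ is a strong fuzzy incidence graph.
   Context: Fuzzy incidence graphs. All graphs are finite, simple and undirected; $\wedge$ denotes minimum. A fuzzy incidence graph (FIG) $X=(V,E,I,\varepsilon,\rho,\eta)$ consists of a nonempty finite vertex set $V$, a set $E$ of edges $xy=yx$ ($x\neq y$ in $V$), a set $I$ of (incidence) pairs $(x,xy)$ with $xy\in E$ and $x$ an endpoint of $xy$, and functions $\varepsilon:V\to(0,1]$, $\rho:E\to(0,1]$, $\eta:I\to(0,1]$ with $\rho(xy)\le\varepsilon(x)\wedge\varepsilon(y)$ for all $xy\in E$ and $\eta(x,xy)\le\varepsilon(x)\wedge\rho(xy)$ for all $(x,xy)\in I$ (vertices, edges, pairs of weight $0$ are regarded as absent). The number $\eta(x,xy)$ is the weight of the pair $(x,xy)$. Strong pairs. For $(a,ab)\in I$, an incidence path from $a$ to $ab$ in $X\setminus(a,ab)$ is a sequence $x_0=a,(x_0,x_0x_1),x_0x_1,(x_1,x_0x_1),x_1,\dots,x_k=b,(b,ab),ab$ with $k\ge2$, the vertices $x_0,\dots,x_k$ distinct, and all listed edges in $E$ and pairs in $I$; its incidence strength is the minimum weight of its pairs. $ICONN_{X\setminus(a,ab)}(a,ab)$ is the maximum incidence strength over all such paths ($0$ if there are none). The pair $(a,ab)$ is strong if $\eta(a,ab)\ge ICONN_{X\setminus(a,ab)}(a,ab)$. A strong fuzzy incidence graph (SFIG) is a FIG all of whose pairs are strong. Cartesian product. For FIGs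 $X_i=(V_i,E_i,I_i,\varepsilon_i,\rho_i,\eta_i)$, $i=1,2$, the Cartesian product $X_1\times X_2=(V,E,I,\varepsilon,\rho,\eta)$ has $V=V_1\times V_2$; $E=\{(a_1,b_1)(a_2,b_2): a_1=a_2,\ b_1b_2\in E_2\ \text{or}\ a_1a_2\in E_1,\ b_1=b_2\}$; $I$ is the set of pairs $((a_1,b_1),(a_1,b_1)(a_2,b_2))$ such that either $a_1=a_2$ and both $(b_1,b_1b_2),(b_2,b_1b_2)\in I_2$, or $b_1=b_2$ and both $(a_1,a_1a_2),(a_2,a_1a_2)\in I_1$; $\varepsilon(a,b)=\varepsilon_1(a)\wedge\varepsilon_2(b)$; $\rho((a_1,b_1)(a_2,b_2))$ equals $\varepsilon_1(a_1)\wedge\rho_2(b_1b_2)$ if $a_1=a_2$, and $\rho_1(a_1a_2)\wedge\varepsilon_2(b_1)$ if $b_1=b_2$; $\eta((a_1,b_1),(a_1,b_1)(a_2,b_2))$ equals $\varepsilon_1(a_1)\wedge\eta_2(b_1,b_1b_2)$ if $a_1=a_2$, and $\eta_1(a_1,a_1a_2)\wedge\varepsilon_2(b_1)$ if $b_1=b_2$. *)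

(* Defs.v *)
From HB Require Import structures.
From mathcomp Require Import all_boot all_order all_algebra.
From mathcomp Require Import reals.

Set Implicit Arguments.
Unset Strict Implicit.
Unset Printing Implicit Defensive.

Import Order.TTheory GRing.Theory Num.Theory.
Local Open Scope ring_scope.

(* The data (E, I, eps, rho, eta) of a fuzzy incidence graph on the vertex set
   V. An edge xy is given by its two endpoints, in either order. An incidence
   pair (x, xy) is given by the ordered pair x, y: [inc x y] says that (x, xy)
   is in I and [eta x y] is the weight of (x, xy), while [inc y x] and
   [eta y x] are about (y, xy). The weight functions are total; their values
   outside E and I are never used. *)
Record figData (R : realType) (V : finType) := FigData {
  edge : rel V;
  inc  : rel V;
  eps  : V -> R;
  rho  : V -> V -> R;
  eta  : V -> V -> R
}.

Record isFIG (R : realType) (V : finType) (X : figData R V) : Prop := IsFIG {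
  fig_nonempty : (0 < #|V|)%N;
  fig_edge_irr : irreflexive (edge X);
  fig_edge_sym : symmetric (edge X);
  fig_inc_edge : forall x y, inc X x y -> edge X x y;
  fig_rho_sym  : forall x y, edge X x y -> rho X x y = rho X y x;
  fig_eps01    : forall x, 0 < eps X x <= 1;
  fig_rho01    : forall x y, edge X x y -> 0 < rho X x y <= 1;
  fig_eta01    : forall x y, inc X x y -> 0 < eta X x y <= 1;
  fig_rho_le   : forall x y, edge X x y ->
                   rho X x y <= Num.min (eps X x) (eps X y);
  fig_eta_le   : forall x y, inc X x y ->
                   eta X x y <= Num.min (eps X x) (rho X x y)
}.

Section Strong.
Variables (R : realType) (V : finType) (X : figData R V).

Definition inc_step : rel V :=
  [rel x y | [&& edge X x y, inc X x y & inc X y x]].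

(* The incidence path x_0 = a, ..., x_k = b, (b, ab), ab is given by the
   sequence p = x_1, ..., x_k, so that k = size p. As the x_i are distinct and
   k >= 2, such a path never uses the deleted pair (a, ab). *)
Definition inc_path (a b : V) (p : seq V) : bool :=
  [&& (2 <= size p)%N, uniq (a :: p), path inc_step a p, last a p == b,
      inc X b a & edge X a b].

(* [zip (a :: p) p] lists the steps (x_i, x_(i+1)). The initial value
   [eta X b a] is the weight of the last pair (b, ab). *)
Definition inc_strength (a b : V) (p : seq V) : R :=
  \big[Num.min/eta X b a]_(xy <- zip (a :: p) p)
     Num.min (eta X xy.1 xy.2) (eta X xy.2 xy.1).

(* Distinctness bounds the length of p by #|V|, so no path is missed. *)
Definition iconn (a b : V) : R :=
  \big[Num.max/0]_(p : #|V|.-bseq V | inc_path a b p) inc_strength a b p.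

Definition strong_pair (a b : V) : bool := iconn a b <= eta X a b.

Definition isSFIG : Prop :=
  isFIG X /\ forall a b, inc X a b -> strong_pair a b.

End Strong.

(* In [rho] and [eta] the test [u.1 == v.1] separates the two kinds of edges,
   because E1 and E2 are irreflexive. *)
Definition cartProd (R : realType) (V1 V2 : finType)
    (X1 : figData R V1) (X2 : figData R V2) : figData R (V1 * V2)%type := {|
  edge := fun u v =>
    (u.1 == v.1) && edge X2 u.2 v.2 || edge X1 u.1 v.1 && (u.2 == v.2);
  inc := fun u v =>
    [&& u.1 == v.1, inc X2 u.2 v.2 & inc X2 v.2 u.2]
    || [&& u.2 == v.2, inc X1 u.1 v.1 & inc X1 v.1 u.1];
  eps := fun u => Num.min (eps X1 u.1) (eps X2 u.2);
  rho := fun u v =>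
    if u.1 == v.1 then Num.min (eps X1 u.1) (rho X2 u.2 v.2)
    else Num.min (rho X1 u.1 v.1) (eps X2 u.2);
  eta := fun u v =>
    if u.1 == v.1 then Num.min (eps X1 u.1) (eta X2 u.2 v.2)
    else Num.min (eta X1 u.1 v.1) (eps X2 u.2)
|}.

(* Main.v *)
(** Project the product to a factor. An edge of the product either collapses to
    a vertex or lies over an edge of the factor, and in the second case its
    pairs weigh at most as much as the pairs of that edge. An incidence path of
    strength [s] around a pair lying over the pair [(a, ab)] of the factor
    therefore projects to a walk from [a] to [b] whose pairs weigh at least [s].
    Shortened, this walk is either the edge [ab] itself, so that [(a, ab)]
    weighs at least [s], or an incidence path around [(a, ab)], which is strong.
    The other factor contributes only a vertex weight, which bounds [s] because
    it also enters the weight of the last pair of the path. *)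

Require Import Defs.
From mathcomp Require Import all_boot all_order all_algebra.
From mathcomp Require Import reals.

Set Implicit Arguments.
Unset Strict Implicit.
Unset Printing Implicit Defensive.

Import Order.TTheory GRing.Theory Num.Theory.
Local Open Scope ring_scope.

(** Thresholding the weights at [s] turns the max-min value [iconn] into reachability, which
    [connect] handles without requiring distinct vertices. *)
Definition step_ge (R : realType) (V : finType) (X : figData R V) (s : R) :
    rel V :=
  [rel x y | inc_step X x y && (s <= Num.min (eta X x y) (eta X y x))].

Section Strength.
Variables (R : realType) (V : finType) (X : figData R V).

Lemma le_bigmin_zip_path (s z : R) (w : V -> V -> R) (a : V) (p : seq V) :
  (s <= \big[Num.min/z]_(xy <- zip (a :: p) p) w xy.1 xy.2) =
  (s <= z) && path [rel x y | s <= w x y] a p.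
Proof.
elim: p a => [|b p IHp] a; first by rewrite big_nil andbT.
by rewrite /= big_cons le_min IHp andbCA.
Qed.

Lemma le_inc_strength (s : R) (a b : V) (p : seq V) :
  path (inc_step X) a p ->
  (s <= inc_strength X a b p) = (s <= eta X b a) && path (step_ge X s) a p.
Proof.
move=> pathp; rewrite /inc_strength.
rewrite (le_bigmin_zip_path _ _ (fun x y => Num.min (eta X x y) (eta X y x))).
congr (_ && _); elim: p a pathp => // c p IHp a /andP[stepac /IHp pathE].
by congr (_ && _) => //; move: stepac; rewrite /step_ge /= => ->.
Qed.

Lemma le_iconn (a b : V) (p : seq V) :
  inc_path X a b p -> inc_strength X a b p <= iconn X a b.
Proof.
move=> incp; have /and3P[_ /= /andP[_ uniqp] _] := incp.
have szp : (size p <= #|V|)%N by rewrite -(card_uniqP uniqp) max_card.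
exact: (@le_bigmax_cond _ _ _ _ (Bseq szp) (fun p => inc_path X a b p)
          (fun p => inc_strength X a b p)).
Qed.

(** The bound on [eta X b a] is a separate hypothesis because every incidence path ends with the
    pair $(b,ab)$, which a walk from [a] to [b] may avoid. *)
Lemma sfig_le_eta (s : R) (a b : V) :
  isSFIG X -> inc X a b -> inc X b a -> s <= eta X b a ->
  connect (step_ge X s) a b -> s <= eta X a b.
Proof.
move=> [figX strongX] incab incba les /connectP[p0 pathp0 lastb].
(* With [b] written as the end of the walk, [shortenP] carries the endpoint over to the shortened
   path. *)
move: lastb incab incba les => ->.
case/shortenP: pathp0 => p pathp uniqp _ incab incba les.
have edgeab := fig_inc_edge figX incab.
(* An empty path would make $ab$ a loop; a single step is the edge $ab$, whose pairs weigh at least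
   [s]; two or more steps give $k\ge 2$. *)
case: p => [|x [|y p]] in pathp uniqp incab incba les edgeab *.
- by move: edgeab; rewrite /= (fig_edge_irr figX).
- by move: pathp => /= /andP[/andP[_]]; rewrite le_min => /andP[].
set q := [:: x, y & p] in pathp uniqp incab incba les edgeab *.
have stepp : path (inc_step X) a q.
  by apply: sub_path pathp => u v /andP[].
have incq : inc_path X a (last a q) q.
  by apply/and5P; split=> //; apply/andP.
apply: le_trans (strongX _ _ incab); apply: le_trans (le_iconn incq).
by rewrite le_inc_strength // les.
Qed.

(** It suffices to take for [s] the strength of each incidence path in turn; nonnegativity of
    [eta X a b] covers the default value 0 of the maximum. *)
Lemma strong_pair_connect (a b : V) :
  0 <= eta X a b ->
  (forall s, s <= eta X b a -> connect (step_ge X s) a b -> s <= eta X a b) ->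
  strong_pair X a b.
Proof.
move=> eta_ge0 connP; apply: bigmax_le => // p /and5P[_ _ stepp /eqP lastp _].
have := lexx (inc_strength X a b p).
rewrite {1}le_inc_strength // => /andP[les pathp]; apply: connP => //.
by apply/connectP; exists p.
Qed.

Lemma edge_neq (x y : V) : isFIG X -> edge X x y -> (x == y) = false.
Proof.
by move=> figX exy; apply: contraTF exy => /eqP ->; rewrite (fig_edge_irr figX).
Qed.

End Strength.

Section Product.
Variables (R : realType) (V1 V2 : finType).
Variables (X1 : figData R V1) (X2 : figData R V2).
Hypotheses (fig1 : isFIG X1) (fig2 : isFIG X2).

Lemma cartProd_fig : isFIG (cartProd X1 X2).
Proof.
have rho_le (u v : V1 * V2) : edge (cartProd X1 X2) u v ->
    rho (cartProd X1 X2) u v <=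
    Num.min (eps (cartProd X1 X2) u) (eps (cartProd X1 X2) v).
  case: u v => [a b] [c d] /= /orP[/andP[/eqP <- e2]|/andP[e1 /eqP <-]].
    have := fig_rho_le fig2 e2; rewrite eqxx !le_min !ge_min => /andP[-> ->].
    by rewrite lexx !orbT.
  rewrite (edge_neq fig1 e1).
  have := fig_rho_le fig1 e1; rewrite !le_min !ge_min => /andP[-> ->].
  by rewrite lexx !orbT.
(* [rho_le] settles the bound on [rho] here; the other fields follow in order. *)
split=> //=.
- by rewrite card_prod muln_gt0 (fig_nonempty fig1) (fig_nonempty fig2).
- by move=> u; rewrite (fig_edge_irr fig1) (fig_edge_irr fig2) andbF.
- move=> u v; rewrite (fig_edge_sym fig1) (fig_edge_sym fig2).
  by rewrite (eq_sym u.1) (eq_sym u.2).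
- move=> u v /orP[/and3P[-> /(fig_inc_edge fig2) -> _] //|].
  by case/and3P=> -> /(fig_inc_edge fig1) -> _; rewrite orbT.
- move=> [a b] [c d] /= /orP[/andP[/eqP <- e2]|/andP[e1 /eqP <-]].
    by rewrite eqxx (fig_rho_sym fig2).
  have ac := edge_neq fig1 e1.
  by rewrite [c == a]eq_sym ac (fig_rho_sym fig1).
- move=> u; have /andP[e1 e1'] := fig_eps01 fig1 u.1.
  have /andP[e2 _] := fig_eps01 fig2 u.2.
  by rewrite lt_min ge_min e1 e2 e1'.
- move=> [a b] [c d] /=; have /andP[a0 a1] := fig_eps01 fig1 a.
  have /andP[b0 b1] := fig_eps01 fig2 b.
  case/orP=> [/andP[/eqP <- e2]|/andP[e1 /eqP <-]].
    have /andP[r0 r1] := fig_rho01 fig2 e2.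
    by rewrite eqxx lt_min ge_min a0 r0 a1.
  have /andP[r0 r1] := fig_rho01 fig1 e1.
  rewrite (edge_neq fig1 e1).
  by rewrite lt_min ge_min r0 b0 r1.
- move=> [a b] [c d] /=; have /andP[a0 a1] := fig_eps01 fig1 a.
  have /andP[b0 b1] := fig_eps01 fig2 b.
  case/orP=> [/and3P[/eqP <- i2 _]|/and3P[/eqP <- i1 _]].
    have /andP[r0 r1] := fig_eta01 fig2 i2.
    by rewrite eqxx lt_min ge_min a0 r0 a1.
  have /andP[r0 r1] := fig_eta01 fig1 i1.
  rewrite (edge_neq fig1 (fig_inc_edge fig1 i1)).
  by rewrite lt_min ge_min r0 b0 r1.
move=> [a b] [c d] /= /orP[/and3P[/eqP <- i2 _]|/and3P[/eqP <- i1 _]].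
  have := fig_eta_le fig2 i2; rewrite eqxx !le_min !ge_min => /andP[-> ->].
  by rewrite lexx !orbT.
rewrite (edge_neq fig1 (fig_inc_edge fig1 i1)).
have := fig_eta_le fig1 i1; rewrite !le_min !ge_min => /andP[-> ->].
by rewrite lexx !orbT.
Qed.

Lemma step_ge_cartProd (s : R) (u v : V1 * V2) :
  step_ge (cartProd X1 X2) s u v ->
  (u.1 == v.1) && step_ge X2 s u.2 v.2 || step_ge X1 s u.1 v.1 && (u.2 == v.2).
Proof.
case: u v => [a b] [c d]; rewrite /step_ge /inc_step /= => /andP[/and3P[_ incuv _]].
case/orP: incuv => [/and3P[/eqP ac ibd idb]|/and3P[/eqP bd iac ica]].
  move: ac ibd idb => /= <- ibd idb; rewrite eqxx !le_min !ibd !idb.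
  by rewrite (fig_inc_edge fig2 ibd) => /andP[/andP[_ ->] /andP[_ ->]].
move: bd iac ica => /= <- iac ica.
have ac := edge_neq fig1 (fig_inc_edge fig1 iac).
rewrite [c == a]eq_sym ac eqxx iac ica !le_min.
by rewrite (fig_inc_edge fig1 iac) => /andP[/andP[-> _] /andP[-> _]].
Qed.

(** Each step moves one coordinate along a step of its factor and fixes the other, so both
    projections are handled in one induction. *)
Lemma connect_cartProd (s : R) (u v : V1 * V2) :
  connect (step_ge (cartProd X1 X2) s) u v ->
  connect (step_ge X1 s) u.1 v.1 && connect (step_ge X2 s) u.2 v.2.
Proof.
case/connectP=> p + ->; elim: p u => /= [|w p IHp] u; first by rewrite !connect0.
case/andP=> /step_ge_cartProd uw /IHp /andP[wv1 wv2].
case/orP: uw => [/andP[/eqP -> uw]|/andP[uw /eqP ->]].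
  by rewrite wv1 (connect_trans (connect1 uw) wv2).
by rewrite wv2 (connect_trans (connect1 uw) wv1).
Qed.

End Product.

Theorem theorem4p4 (R : realType) (V1 V2 : finType)
    (X1 : figData R V1) (X2 : figData R V2) :
  isSFIG X1 -> isSFIG X2 -> isSFIG (cartProd X1 X2).
Proof.
move=> sfig1 sfig2; have [[fig1 _] [fig2 _]] := (sfig1, sfig2).
have fig := cartProd_fig fig1 fig2; split=> // u v incuv.
apply: strong_pair_connect => [|s].
  by have /andP[/ltW] := fig_eta01 fig incuv.
move=> + /(connect_cartProd fig1 fig2)/andP[].
case: u v incuv => [a b] [c d] /=.
case/orP=> [/and3P[/eqP <- ibd idb]|/and3P[/eqP <- iac ica]].
  (* The weight of the last pair is a minimum containing [eps X1 a], a term shared by both pairs of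
     this edge; what remains is a claim in [X2]. *)
  rewrite eqxx !le_min => /andP[-> les] _.
  exact: sfig_le_eta.
have ac := edge_neq fig1 (fig_inc_edge fig1 iac).
rewrite [c == a]eq_sym ac !le_min => /andP[les ->] conn _.
by rewrite andbT; apply: sfig_le_eta conn.
Qed.
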